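(* Let $\mathcal V$ be a congruence modular variety and let $A\in\mathcal V$ be an absolute retract in $\mathcal V$. If the congruence lattice $\mathrm{Con}(A)$ is finite dimensional, then $A$ is (isomorphic to) a finite product of subdirectly irreducible algebras.
   Context: Algebras are universal algebras with nonempty universe. A variety is congruence modular if every algebra in it has a modular congruence lattice. $\mathrm{Con}(A)$ is the lattice of congruences of $A$. An algebra $R\in\mathcal V$ is an absolute retract in $\mathcal V$ if for every embedding $e\colon R\to B$ with $B\in\mathcal V$ there is a surjective homomorphism $p\colon B\to R$ with $p\circ e=\mathrm{id}_R$. ''$\mathrm{Con}(A)$ is finite dimensional'' means that the lattice $\mathrm{Con}(A)$ has finite height, i.e. there is a finite bound on the lengths of its chains. An algebra is subdirectly irreducible if it has a smallest nonzero congruence (its zero congruence is completely meet irreducible). A one-element algebra counts as the product of the empty family. *)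

(* Defs.v *)
From HB Require Import structures.
From mathcomp Require Import all_boot all_order.
From mathcomp Require Import boolp.
Set Implicit Arguments.
Unset Strict Implicit.
Unset Printing Implicit Defensive.
Import Order.TTheory.
Local Open Scope order_scope.

Record signature := Signature {
  symbol : Type;
  arity : symbol -> nat
}.

Record algebra (S : signature) := Algebra {
  carrier :> Type;
  op : forall f : symbol S, ('I_(arity f) -> carrier) -> carrier;
  algebra_nonempty : inhabited carrier
}.
Arguments op {S} A f x : rename.

Record hom (S : signature) (A B : algebra S) := Hom {
  hom_fun :> A -> B;
  hom_op : forall (f : symbol S) (x : 'I_(arity f) -> A),
    hom_fun (op A f x) = op B f (fun k => hom_fun (x k))
}.

Definition surjective (T U : Type) (f : T -> U) := forall y, exists x, f x = y.

Definition isomorphic (S : signature) (A B : algebra S) :=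
  exists h : hom A B, bijective h.

Section Product.
Context (S : signature) (I : Type) (A : I -> algebra S).

Lemma prod_nonempty : inhabited (forall i, A i).
Proof.
have ne i : exists x : A i, True by case: (algebra_nonempty (A i)) => x; exists x.
exact: inhabits (fun i => projT1 (cid (ne i))).
Qed.

Definition prod_alg : algebra S :=
  @Algebra S (forall i, A i) (fun f x i => op (A i) f (fun k => x k i))
    prod_nonempty.

End Product.

(* The algebras of a class all live in one fixed universe, which is also the
   universe of the index types I below. Closure under S is closure under
   isomorphic copies of subalgebras. *)
Record variety (S : signature) (V : algebra S -> Prop) : Prop := Variety {
  varietyH : forall (A B : algebra S) (h : hom A B), surjective h -> V A -> V B;
  varietyS : forall (A B : algebra S) (h : hom A B), injective h -> V B -> V A;
  varietyP : forall (I : Type) (A : I -> algebra S),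
    (forall i, V (A i)) -> V (prod_alg A)
}.

Record Con (S : signature) (A : algebra S) := Congruence {
  con_rel :> A -> A -> Prop;
  con_refl : forall x, con_rel x x;
  con_sym : forall x y, con_rel x y -> con_rel y x;
  con_trans : forall x y z, con_rel x y -> con_rel y z -> con_rel x z;
  con_op : forall (f : symbol S) (x y : 'I_(arity f) -> A),
    (forall k, con_rel (x k) (y k)) -> con_rel (op A f x) (op A f y)
}.

HB.instance Definition _ (S : signature) (A : algebra S) := gen_eqMixin (Con A).
HB.instance Definition _ (S : signature) (A : algebra S) :=
  gen_choiceMixin (Con A).

Section ConLattice.
Context (S : signature) (A : algebra S).
Implicit Types a b c : Con A.

Lemma con_eq a b : (forall x y, a x y <-> b x y) -> a = b.
Proof.
case: a b => [r r1 r2 r3 r4] [s s1 s2 s3 s4] /= rs.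
have E : r = s by apply/funext => x; apply/funext => y; apply/propext.
by case: _ / E in s1 s2 s3 s4 rs *; congr Congruence; apply: Prop_irrelevance.
Qed.

Definition con_le a b : bool := `[< forall x y, a x y -> b x y >].

Lemma con_le_refl : reflexive con_le.
Proof. by move=> a; apply/asboolP. Qed.

Lemma con_le_anti : antisymmetric con_le.
Proof.
move=> a b /andP[/asboolP ab /asboolP ba].
by apply: con_eq => x y; split; [exact: ab | exact: ba].
Qed.

Lemma con_le_trans : transitive con_le.
Proof.
move=> b a c /asboolP ab /asboolP bc.
by apply/asboolP => x y /ab /bc.
Qed.

Definition con_bot : Con A.
Proof.
exists (fun x y => x = y) => //; first by move=> x y z -> ->.
by move=> f x y xy; congr (op A f); apply/funext.
Defined.

Definition con_top : Con A.
Proof. by exists (fun _ _ => True). Defined.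

Definition con_meet a b : Con A.
Proof.
exists (fun x y => a x y /\ b x y).
- by move=> x; split; exact: con_refl.
- by move=> x y [/con_sym ? /con_sym ?].
- by move=> x y z [a1 b1] [a2 b2]; split;
    [exact: con_trans a1 a2 | exact: con_trans b1 b2].
- by move=> f x y xy; split; apply: con_op => k; case: (xy k).
Defined.

Definition con_gen (r : A -> A -> Prop) : Con A.
Proof.
exists (fun x y => forall c, (forall u v, r u v -> c u v) -> c x y).
- by move=> x c _; exact: con_refl.
- by move=> x y xy c rc; apply: con_sym; exact: xy.
- by move=> x y z xy yz c rc; apply: con_trans (xy c rc) (yz c rc).
- by move=> f x y xy c rc; apply: con_op => k; exact: xy.
Defined.

Definition con_join a b : Con A := con_gen (fun x y => a x y \/ b x y).

Lemma con_le_meet a b c : con_le a (con_meet b c) = con_le a b && con_le a c.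
Proof.
apply/asboolP/andP => [abc|[/asboolP ab /asboolP ac] x y axy].
  by split; apply/asboolP => x y /abc[].
by split; [exact: ab | exact: ac].
Qed.

Lemma con_join_le a b c : con_le (con_join a b) c = con_le a c && con_le b c.
Proof.
apply/asboolP/andP => [abc|[/asboolP ac /asboolP bc] x y abxy].
  by split; apply/asboolP => x y xy; apply: abc => d rd; apply: rd; auto.
by apply: abxy => u v []; [exact: ac | exact: bc].
Qed.

Lemma con_bot_le a : con_le con_bot a.
Proof. by apply/asboolP => x _ <-; exact: con_refl. Qed.

Lemma con_le_top a : con_le a con_top.
Proof. exact/asboolP. Qed.

End ConLattice.

Fact con_display : Order.disp_t. Proof. exact: Order.Disp tt tt. Qed.

HB.instance Definition _ (S : signature) (A : algebra S) :=
  Order.Le_isPOrder.Build con_display (Con A)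
    (@con_le_refl S A) (@con_le_anti S A) (@con_le_trans S A).
HB.instance Definition _ (S : signature) (A : algebra S) :=
  Order.POrder_isMeetSemilattice.Build con_display (Con A) (@con_le_meet S A).
HB.instance Definition _ (S : signature) (A : algebra S) :=
  Order.POrder_isJoinSemilattice.Build con_display (Con A) (@con_join_le S A).
HB.instance Definition _ (S : signature) (A : algebra S) :=
  Order.hasBottom.Build con_display (Con A) (@con_bot_le S A).
HB.instance Definition _ (S : signature) (A : algebra S) :=
  Order.hasTop.Build con_display (Con A) (@con_le_top S A).

Definition modular_lattice d (L : latticeType d) :=
  forall x y z : L, x <= z -> x `|` (y `&` z) = (x `|` y) `&` z.

Definition finite_height d (L : porderType d) :=
  exists n : nat, forall c : seq L, sorted <%O c -> (size c <= n)%N.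

Definition congruence_modular (S : signature) (V : algebra S -> Prop) :=
  forall A : algebra S, V A -> modular_lattice (Con A).

Definition absolute_retract (S : signature) (V : algebra S -> Prop)
    (R : algebra S) :=
  V R /\
  forall (B : algebra S) (e : hom R B), V B -> injective e ->
    exists p : hom B R, surjective p /\ forall x, p (e x) = x.

Definition subdirectly_irreducible (S : signature) (A : algebra S) :=
  exists m : Con A, m <> \bot /\ forall c : Con A, c <> \bot -> m <= c.

(* Main.v *)
Require Import Defs.
From mathcomp Require Import all_boot all_order.
From mathcomp Require Import boolp.
From Stdlib Require Import Relation_Operators Operators_Properties.
Set Implicit Arguments.
Unset Strict Implicit.
Unset Printing Implicit Defensive.
Import Order.TTheory.
Local Open Scope order_scope.

(** Since [Con A] has finite height, its zero is the meet of finitely many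
    completely meet irreducible congruences [m_i]; taking as few of them as
    possible makes the family irredundant. Then [A] embeds into the product [B]
    of the subdirectly irreducible quotients [A / m_i], and because [A] is an
    absolute retract the embedding [e] has a left inverse [p]. The kernel of [p]
    meets the image of [A] trivially, so everything follows once the embedding
    is known to be essential: a congruence [t] of [B] whose restriction to [A]
    is zero is itself zero ([irredundant_essential]). Then [p] is injective and
    [e] is an isomorphism.

    For modules essentiality is immediate, since the socle of [B] lies inside
    [A]. In general, call two elements of [B] equal off [i] when their
    coordinates other than the [i]-th agree, and let [mu_i] be the monolith of
    the [i]-th factor. First, modularity lets one shrink a nonzero [t] so that
    it lies below every [mu_i] ([below_socle]). If [t] relates two distinct
    elements that are equal off [i], then modularity makes [t] contain every
    pair that is equal off [i] and [mu_i]-related at [i], and irredundance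
    supplies such a pair in [A] ([trace_off_bot]).

    Otherwise [t] meets equality off [i] trivially for each [i]. A tuple can be
    changed one coordinate at a time, so this makes [t] central: it satisfies
    the term condition against arbitrary changes of parameters
    ([meet_off_central]). Here the abelian side of commutator theory enters
    through one tool, the difference operation [d] of a congruence modular
    variety: [d x x z = z] always, and [d x y y = x] on central congruences
    ([difference_operation]). It makes [t] permute with the projection kernels,
    hence [d] is also Mal'cev on [mu_i] for every coordinate [i] at which [t] is
    not trivial, hence in [A] the kernel of the [i]-th coordinate permutes with
    the trace of the [i]-th part of the socle. So in an element of [A] the
    [i]-th coordinate may be replaced by any [mu_i]-related one without leaving
    [A]; doing this coordinate by coordinate, every element [t]-related to an
    element of [A] lies in [A], hence equals it. But [d x y a] is [t]-related to
    [a] for [t x y], and centrality turns [d x y a = a] into [x = y]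
    ([trace_socle_bot]). *)

(** * Congruences *)

Section Congruences.
Context (S : signature) (A : algebra S).
Implicit Types a b c : Con A.

Lemma con_leP a b : reflect (forall x y, a x y -> b x y) (a <= b).
Proof. exact: asboolP. Qed.

Lemma con_neq_bot a x y : a x y -> x <> y -> a <> \bot.
Proof. by move=> axy xy a0; apply: xy; move: axy; rewrite a0. Qed.

Lemma con_eq_bot a : (forall x y, a x y -> x = y) -> a = \bot.
Proof.
move=> a0; apply: con_eq => x y; split=> [/a0 // | xy].
by rewrite [x]xy; exact: con_refl.
Qed.

Lemma con_not_leP a b : ~ a <= b -> exists x y, a x y /\ ~ b x y.
Proof.
move=> ab; apply: contrapT => N; apply: ab; apply/con_leP => x y axy.
by apply: contrapT => nb; apply: N; exists x, y.
Qed.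

Lemma con_neq_botP a : a <> \bot -> exists x y, a x y /\ x <> y.
Proof.
move=> a0; apply: contrapT => N; apply: a0; apply: con_eq_bot => x y axy.
by apply: contrapT => xy; apply: N; exists x, y.
Qed.

(** The join is defined as an intersection of congruences; this is its
    description by finite chains, on which one can argue by induction. *)
Lemma con_join_steps a b x y :
  (a `|` b) x y ->
  clos_refl_trans_1n A (fun u v => a u v \/ b u v) x y.
Proof.
move=> abxy; apply: clos_rt_rt1n.
set r := (fun u v => a u v \/ b u v).
have r_sym u v : r u v -> r v u by case=> /con_sym; [left | right].
have star_sym u v : clos_refl_trans A r u v -> clos_refl_trans A r v u.
  elim=> [p q /r_sym|p|p q s _ qp _ sq]; [exact: rt_step | exact: rt_refl |].
  exact: rt_trans sq qp.
(* Arguments are replaced one at a time, so that each elementary step happens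
   inside a single unary polynomial. *)
have star_op (f : symbol S) (u v : 'I_(arity f) -> A) :
    (forall k, clos_refl_trans A r (u k) (v k)) ->
    clos_refl_trans A r (op A f u) (op A f v).
  move=> uv; pose w j (k : 'I_(arity f)) := if (k < j)%N then v k else u k.
  suff step j : (j <= arity f)%N ->
      clos_refl_trans A r (op A f u) (op A f (w j)).
    have -> : v = w (arity f) by apply/funext => k; rewrite /w ltn_ord.
    exact: step.
  elim: j => [|j IH] jn.
    by have -> : w 0%N = u by []; exact: rt_refl.
  apply: rt_trans (IH (ltnW jn)) _.
  pose g t (k : 'I_(arity f)) :=
    if (k < j)%N then v k else if k == Ordinal jn then t else u k.
  have gu : w j = g (u (Ordinal jn)).
    apply/funext => k; rewrite /w /g; case: ltnP => // _.
    by case: eqP => [->|].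
  have gv : w j.+1 = g (v (Ordinal jn)).
    apply/funext => k; rewrite /w /g ltnS leq_eqVlt.
    case: eqP => [kj|kj] /=.
      have -> : k = Ordinal jn by apply: val_inj.
      by rewrite /= ltnn eqxx.
    case: ltnP => // _; case: eqP => // kE.
    by case: kj; rewrite kE.
  rewrite gu gv; elim: (uv (Ordinal jn)) => [p q pq|p|p q s _ pq _ qs].
  - apply: rt_step; case: pq => pq; [left | right]; apply: con_op => k;
      rewrite /g; case: ifP => _; try exact: con_refl;
      case: ifP => _ //; exact: con_refl.
  - exact: rt_refl.
  - exact: rt_trans pq qs.
pose star : Con A :=
  @Congruence S A (clos_refl_trans A r) (rt_refl A r) star_sym (rt_trans A r)
    star_op.
by apply: (abxy star) => u v; exact: rt_step.
Qed.

(** The usual argument that a Mal'cev operation makes congruences permute; the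
    identity [d x y y = x] is needed on [a]-pairs only, and modulo [b] only. *)
Lemma con_join_comp a b (d : A -> A -> A -> A) :
  (forall x x' y y' z z', a x x' -> a y y' -> a z z' ->
     a (d x y z) (d x' y' z')) ->
  (forall x x' y y' z z', b x x' -> b y y' -> b z z' ->
     b (d x y z) (d x' y' z')) ->
  (forall x z, d x x z = z) ->
  (forall x y, a x y -> b (d x y y) x) ->
  forall x y, (a `|` b) x y -> exists z, a x z /\ b z y.
Proof.
move=> da db dxxz dxyy x y /con_join_steps; elim=> {x y} [x|x y z].
  by exists x; split; exact: con_refl.
move=> [axy|bxy] _ [t [ayt btz]].
  by exists t; split=> //; exact: con_trans axy ayt.
exists (d t y x); split.
  rewrite -[X in a X _](dxxz y x).
  by apply: da; [ | exact: con_refl | exact: con_refl].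
have tz : b (d t y x) (d t y y).
  by apply: db; [exact: con_refl | exact: con_refl | ].
by apply: con_trans tz (con_trans (dxyy _ _ (con_sym ayt)) btz).
Qed.

End Congruences.

Section Homs.
Context (S : signature) (A B : algebra S) (h : hom A B).

Definition con_pull (c : Con B) : Con A.
Proof.
exists (fun x y => c (h x) (h y)).
- by move=> x; exact: con_refl.
- by move=> x y; exact: con_sym.
- by move=> x y z; exact: con_trans.
- by move=> f x y xy; rewrite !hom_op; exact: con_op.
Defined.

Hypothesis h_surj : surjective h.

(** The image congruence. It relates [u] and [v] when all their preimages are
    related, which agrees with the usual existential form because [c] contains
    the kernel, and makes transitivity immediate. *)
Definition con_push (c : Con A) (kc : con_pull \bot <= c) : Con B.
Proof.
exists (fun u v => forall x y, h x = u -> h y = v -> c x y).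
- by move=> u x y xu yu; move/con_leP: kc; apply; rewrite /= xu yu.
- by move=> u v uv x y xv yu; apply: con_sym; exact: uv.
- move=> u v w uv vw x z xu zw; have [y yv] := h_surj v.
  exact: con_trans (uv x y xu yv) (vw y z yv zw).
- move=> f u v uv x y xu yv.
  have [x' x'u] := choice (fun k => h_surj (u k)).
  have [y' y'v] := choice (fun k => h_surj (v k)).
  have xx' : c x (op A f x').
    move/con_leP: kc; apply; rewrite /= xu hom_op.
    by congr (op B f); apply/funext => k.
  have yy' : c (op A f y') y.
    move/con_leP: kc; apply; rewrite /= yv hom_op.
    by congr (op B f); apply/funext => k.
  apply: con_trans xx' (con_trans _ yy').
  by apply: con_op => k; exact: uv.
Defined.

(** By the correspondence theorem the kernel of a homomorphism onto a
    subdirectly irreducible algebra has a least congruence above it, the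
    preimage of the monolith. *)
Lemma monolith_le_join (m : Con B) :
  (forall c : Con B, c <> \bot -> m <= c) ->
  forall c : Con A, ~ c <= con_pull \bot ->
  con_pull m <= con_pull \bot `|` c.
Proof.
move=> mono c /con_not_leP[x [y [cxy hxy]]].
pose k := con_pull \bot `|` c.
have kk : con_pull \bot <= k by exact: leUl.
have : con_push kk <> \bot.
  apply: (@con_neq_bot _ _ _ (h x) (h y)) => // x' y' xx' yy'.
  have kx : k x' x by move/con_leP: kk; apply.
  have ky : k y y' by move/con_leP: kk; apply.
  apply: con_trans kx (con_trans _ ky).
  by have /con_leP := leUr c (con_pull \bot); apply.
by move=> /mono /con_leP mk; apply/con_leP => u v /mk; apply.
Qed.

End Homs.

(** * The difference operation *)

(** These operations stand in for the 4-ary term operations of [B]: they form a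
    subalgebra of a power of [B] containing the projections, and preserving
    congruences and subuniverses is all that is asked of terms below. *)
Definition compatible4 (S : signature) (B : algebra S)
    (g : B -> B -> B -> B -> B) : Prop :=
  (forall (c : Con B) x x' y y' z z' u u',
     c x x' -> c y y' -> c z z' -> c u u' ->
     c (g x y z u) (g x' y' z' u')) /\
  (forall E : B -> Prop,
     (forall (f : symbol S) (x : 'I_(arity f) -> B),
        (forall k, E (x k)) -> E (op B f x)) ->
     forall x y z u, E x -> E y -> E z -> E u -> E (g x y z u)).

Definition compatible3 (S : signature) (B : algebra S)
    (d : B -> B -> B -> B) := compatible4 (fun x y z _ => d x y z).

(** The term condition making [t] centralize the full congruence, with the
    arbitrarily changed parameter in third position. Arity four suffices, as the
    condition is applied only to the operations of a Day chain and to the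
    difference operation. *)
Definition central (S : signature) (B : algebra S) (t : Con B) :=
  forall g, compatible4 g ->
  forall x x' y y' u u' z w, t x x' -> t y y' -> t u u' ->
  g x y z u = g x' y' z u' -> g x y w u = g x' y' w u'.

Section CompatibleAlgebra.
Context (S : signature) (B : algebra S).

Lemma compatible4_op (f : symbol S)
    (g : 'I_(arity f) -> B -> B -> B -> B -> B) :
  (forall k, compatible4 (g k)) ->
  compatible4 (fun x y z u => op B f (fun k => g k x y z u)).
Proof.
move=> gP; split=> [c x x' y y' z z' u u' xx' yy' zz' uu'|
                    E EP x y z u Ex Ey Ez Eu].
  by apply: con_op => k; apply: (gP k).1.
by apply: (EP) => k; apply: ((gP k).2 E EP).
Qed.

Lemma compatible4_proj1 : compatible4 (fun x _ _ _ : B => x).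
Proof. by split=> [c|E _] x x' y y' *. Qed.

Lemma compatible4_proj2 : compatible4 (fun _ x _ _ : B => x).
Proof. by split=> [c|E _] x x' y y' *. Qed.

Lemma compatible4_proj3 : compatible4 (fun _ _ x _ : B => x).
Proof. by split=> [c|E _] x x' y y' *. Qed.

Lemma compatible4_proj4 : compatible4 (fun _ _ _ x : B => x).
Proof. by split=> [c|E _] x x' y y' *. Qed.

Definition compatible_alg : algebra S :=
  @Algebra S {g : B -> B -> B -> B -> B | compatible4 g}
    (fun f g => exist _ _ (compatible4_op (fun k => svalP (g k))))
    (inhabits (exist _ _ compatible4_proj1)).

Lemma compatible_alg_in (V : algebra S -> Prop) :
  variety V -> V B -> V compatible_alg.
Proof.
move=> HV VB.
have VP : V (prod_alg (fun _ : B * B * B * B => B)) by exact: varietyP.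
pose h := @Hom S compatible_alg (prod_alg (fun _ : B * B * B * B => B))
  (fun g i => sval g i.1.1.1 i.1.1.2 i.1.2 i.2) (fun _ _ => erefl).
apply: (varietyS HV (h := h)) VP => -[g gP] [g' g'P] gg'.
have E : g = g'.
  apply/funext => x; apply/funext => y; apply/funext => z; apply/funext => u.
  exact: (congr1 (fun k => k (x, y, z, u)) gg').
by case: _ / E in g'P gg' *; congr exist; exact: Prop_irrelevance.
Qed.

(** The congruence identifying operations that agree on the quadruples in [P],
    the kernel of an identification of variables. *)
Definition con_agree (P : B -> B -> B -> B -> Prop) : Con compatible_alg.
Proof.
exists (fun g g' => forall x y z u, P x y z u ->
          sval g x y z u = sval g' x y z u) => //.
- by move=> g g' gg' x y z u /gg'.
- by move=> g g' g'' gg' g'g'' x y z u Pxyzu; rewrite gg' // g'g''.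
- move=> f g g' gg' x y z u Pxyzu /=; congr (op B f); apply/funext => k.
  exact: gg'.
Defined.

(** Modularity in the algebra of compatible operations produces a Day chain
    from the first to the last projection, whose members satisfy
    [g x y y x = x]. Along the chain one builds ternary operations [d] with
    [d x x z = z] such that [d x y y] follows [g y y x x] on central pairs. At
    the first projection this value is [y], which [d x y z := z] achieves, and
    at the last one it is [x], as required. *)
Lemma difference_operation (V : algebra S -> Prop) :
  variety V -> congruence_modular V -> V B ->
  exists d : B -> B -> B -> B,
    [/\ compatible3 d,
        forall x z, d x x z = z &
        forall t : Con B, central t -> forall x y, t x y -> d x y y = x].
Proof.
move=> HV Hmod VB.
pose a := con_agree (fun x y z u => x = y /\ z = u).
pose b := con_agree (fun x y z u => x = u /\ y = z).
pose c := con_agree (fun x y z u => y = z).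
pose X : compatible_alg := exist _ _ compatible4_proj1.
pose Y : compatible_alg := exist _ _ compatible4_proj2.
pose Z : compatible_alg := exist _ _ compatible4_proj3.
pose U : compatible_alg := exist _ _ compatible4_proj4.
have cb : c <= b by apply/con_leP => g g' gg' x y z u [_]; exact: gg'.
have XU : (c `|` (a `&` b)) X U.
  rewrite (Hmod _ (compatible_alg_in HV VB)) //; split; last first.
    by move=> x y z u [].
  have aj : a <= c `|` a by exact: leUr.
  have cj : c <= c `|` a by exact: leUl.
  have XY : (c `|` a) X Y by move/con_leP: aj; apply=> x y z u [].
  have YZ : (c `|` a) Y Z by move/con_leP: cj; apply.
  have ZU : (c `|` a) Z U by move/con_leP: aj; apply=> x y z u [].
  exact: con_trans XY (con_trans YZ ZU).
pose tracks (g : compatible_alg) := exists d : B -> B -> B -> B,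
    [/\ compatible3 d,
        forall x z, d x x z = z &
        forall t : Con B, central t -> forall x y, t x y ->
          d x y y = sval g y y x x].
suff [d [dP dxx dt]] : tracks U by exists d.
have trX : tracks X.
  by exists (fun x y z => z); split=> //; exact: compatible4_proj3.
have bX : forall x y, sval X x y y x = x by [].
move: XU bX trX => /con_join_steps; elim=> {X Y Z U} // f g h fg _ IH fx.
move=> [d [dP dxx dt]].
have gx x y : sval g x y y x = x.
  rewrite -[RHS](fx x y); case: fg => [fg|[_ fg]]; last by rewrite fg.
  by rewrite fg.
apply: IH => //; case: fg => [fg|[fg _]]; last first.
  by exists d; split=> // t tc x y xy; rewrite (dt t) // fg.
move: (svalP f) (svalP g) => fP gP.
pose e x y z := sval f (d x y z) x y (d x y z).
(* The values at [y y x x] may change only at a step where [f] and [g] agree on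
   [x y y u]. In the affine case [d x y z] is [z + k (x - y)]; the inner [f]
   adds the multiple of [x - y] given by the coefficient of [f] at its second
   variable, the outer [g] subtracts the one given by the coefficient of [g]. *)
exists (fun x y z => sval g (e x y z) y x (e x y z)); split.
- split.
    move=> k x x' y y' z z' u u' xx' yy' zz' uu'.
    have dd : k (d x y z) (d x' y' z') by apply: (dP.1 k) uu'.
    have ee : k (e x y z) (e x' y' z') by apply: fP.1.
    exact: gP.1.
  move=> E EP x y z u Ex Ey Ez Eu.
  have Ed : E (d x y z) by apply: (dP.2 E EP) Eu.
  have Ee : E (e x y z) by apply: (fP.2 E EP).
  exact: (gP.2 E EP).
- by move=> x z; rewrite /e dxx fx gx.
- move=> t tc x y txy.
  have tyx := con_sym txy.
  pose p := sval f y y x x.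
  have tpx : t p x.
    by rewrite -(fx x x); apply: fP.1 => //; exact: con_refl.
  have tpy : t p y by exact: con_trans tpx txy.
  (* The term condition in the third argument, from [f p x x p = p]. *)
  have fp : sval f p x y p = sval f y y y x.
    apply: (tc _ fP _ _ _ _ _ _ x y) => //; exact: fx.
  pose q := sval f y y y x.
  have tqx : t q x.
    by rewrite -(fx x x); apply: fP.1 => //; exact: con_refl.
  have tqy : t q y by exact: con_trans tqx txy.
  rewrite /e (dt t tc x y txy) -/p fp -/q.
  (* The term condition again, from [g q y y q = q = g y y y x]. *)
  apply: (tc _ gP _ _ _ _ _ _ y x) => //; first exact: con_refl.
  rewrite gx /q; exact: fg.
Qed.

End CompatibleAlgebra.

(** * Irredundant subdirect products *)

Section Essential.
Context (S : signature) (n : nat) (C : 'I_n -> algebra S).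
Local Notation B := (prod_alg C).

Definition proj (i : 'I_n) : hom B (C i) :=
  @Hom S B (C i) (fun x => x i) (fun _ _ => erefl).

Definition con_off (i : 'I_n) : Con B.
Proof.
exists (fun x y : B => forall j, j != i -> x j = y j) => //.
- by move=> x y xy j /xy.
- by move=> x y z xy yz j ji; rewrite xy // yz.
- move=> f x y xy j ji /=; congr (op (C j) f); apply/funext => k.
  exact: xy.
Defined.

(** If two values [g x y z u] and [g x' y' z u'] coincide, then changing one
    coordinate of [z] keeps them [t]-related and equal off that coordinate,
    hence equal. Finitely many such changes reach any [w]. *)
Lemma meet_off_central (t : Con B) :
  (forall i, t `&` con_off i = \bot) -> central t.
Proof.
move=> t0 g gP x x' y y' u u' z w xx' yy' uu' gz.
pose v j : B := fun i : 'I_n => if (i < j)%N then w i else z i.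
suff step j : (j <= n)%N -> g x y (v j) u = g x' y' (v j) u'.
  have -> : w = v n.
    by apply: functional_extensionality_dep => i; rewrite /v ltn_ord.
  exact: step.
elim: j => [|j IH] jn; first exact: gz.
pose i := Ordinal jn.
have vv : con_off i (v j) (v j.+1).
  move=> k ki; rewrite /v ltnS [(k <= j)%N]leq_eqVlt.
  by case: eqP => // kj; case/eqP: ki; apply: val_inj.
suff : (t `&` con_off i) (g x y (v j.+1) u) (g x' y' (v j.+1) u').
  by rewrite t0.
split; first by apply: gP.1 => //; exact: con_refl.
have l : con_off i (g x y (v j.+1) u) (g x y (v j) u).
  apply: gP.1; [exact: con_refl | exact: con_refl | | exact: con_refl].
  exact: con_sym.
have r : con_off i (g x' y' (v j) u') (g x' y' (v j.+1) u').
  by apply: gP.1; [exact: con_refl | exact: con_refl | | exact: con_refl].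
by apply: con_trans l _; rewrite (IH (ltnW jn)).
Qed.

Context (V : algebra S -> Prop) (HV : variety V) (Hmod : congruence_modular V).
Context (A : algebra S) (e : hom A B) (VA : V A) (VB : V B).
Context (m : forall i, Con (C i)).
Hypothesis m_neq : forall i, m i <> \bot.
Hypothesis m_min : forall i (c : Con (C i)), c <> \bot -> m i <= c.
Hypothesis e_inj : injective e.
Hypothesis e_surj : forall i (u : C i), exists a, e a i = u.
Hypothesis e_irr : forall i, exists a b, a <> b /\ con_off i (e a) (e b).

Let coord (i : 'I_n) : hom A (C i) :=
  @Hom S A (C i) (fun a => e a i)
    (fun f x => congr1 (fun b : B => b i) (hom_op e x)).

Let proj_surj i : surjective (proj i).
Proof. by move=> u; have [a au] := e_surj u; exists (e a). Qed.

Let coord_surj i : surjective (coord i).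
Proof. exact: e_surj. Qed.

Let monoB i (c : Con B) : ~ c <= con_pull (proj i) \bot ->
  con_pull (proj i) (m i) <= con_pull (proj i) \bot `|` c.
Proof. exact: (monolith_le_join (@proj_surj i) (@m_min i)). Qed.

Let monoA i (c : Con A) : ~ c <= con_pull (coord i) \bot ->
  con_pull (coord i) (m i) <= con_pull (coord i) \bot `|` c.
Proof. exact: (monolith_le_join (@coord_surj i) (@m_min i)). Qed.

(** The trace on [A] of the [i]-th atom of the socle of the product. *)
Let nu i : Con A := con_pull e (con_off i) `&` con_pull (coord i) (m i).

(** Irredundance makes the pairs equal off [i] escape the kernel of the [i]-th
    coordinate, so their join with it reaches the monolith; modularity then
    allows these pairs to be taken inside the monolith. *)
Let mu_le i : con_pull (coord i) (m i) <= con_pull (coord i) \bot `|` nu i.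
Proof.
rewrite (Hmod VA) ?lexI ?lexx ?andbT; last first.
  by apply/con_leP => a b /= ab; rewrite ab; exact: con_refl.
apply: monoA => /con_leP H; have [a [b [ab oab]]] := e_irr i.
apply: ab; apply: e_inj; apply: functional_extensionality_dep => j.
by have [->|ji] := eqVneq j i; [exact: H | exact: oab].
Qed.

Let pull_le i : con_pull (proj i) \bot <= con_pull (proj i) (m i).
Proof. by apply/con_leP => x y /= xy; rewrite xy; exact: con_refl. Qed.

Let pull_nle i : ~ con_pull (proj i) (m i) <= con_pull (proj i) \bot.
Proof.
move=> /con_leP H; have [u [v [uv nuv]]] := con_neq_botP (@m_neq i).
have [x xu] := proj_surj u; have [y yv] := proj_surj v.
by apply: nuv; rewrite -xu -yv; apply: H; rewrite /= [x i]xu [y i]yv.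
Qed.

(** The socle is essential. Coordinates are treated one after another: either
    the current congruence is trivial at [i] already, or by modularity its meet
    with the preimage of the [i]-th monolith is not. *)
Lemma below_socle (t : Con B) : t <> \bot ->
  exists s : Con B,
    [/\ s <= t, s <> \bot & forall i, s <= con_pull (proj i) (m i)].
Proof.
move=> t0.
suff [s [st s0 sm]] : exists s : Con B, [/\ s <= t, s <> \bot &
    forall i : 'I_n, (i < n)%N -> s <= con_pull (proj i) (m i)].
  by exists s; split=> // i; exact: sm.
suff step j : (j <= n)%N -> exists s : Con B, [/\ s <= t, s <> \bot &
    forall i : 'I_n, (i < j)%N -> s <= con_pull (proj i) (m i)] by exact: step.
elim: j => [|j IH] jn; first by exists t.
have [s [st s0 sm]] := IH (ltnW jn); pose i := Ordinal jn.
have [sp|sp] := pselect (s <= con_pull (proj i) \bot).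
  exists s; split=> // k.
  rewrite ltnS leq_eqVlt => /orP[/eqP kj|]; last exact: sm.
  have -> : k = i by exact: val_inj.
  exact: le_trans sp (pull_le i).
exists (s `&` con_pull (proj i) (m i)); split.
- by rewrite leIx2 // st.
- move=> s'0; apply: (@pull_nle i).
  have := Hmod VB s (pull_le i); rewrite s'0 joinx0 => ->.
  by rewrite lexI lexx andbT; exact: monoB.
- move=> k; rewrite ltnS leq_eqVlt => /orP[/eqP kj|kj].
    have -> : k = i by exact: val_inj.
    exact: leIr.
  by rewrite leIx2 // sm.
Qed.

Section Trace.
Variable t : Con B.
Hypothesis t_trace : forall a b, t (e a) (e b) -> a = b.

(** A nonzero part of [t] inside equality off [i] would contain the [i]-th atom
    of the socle, by modularity, and that atom meets [A] nontrivially. *)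
Lemma trace_off_bot i : t `&` con_off i = \bot.
Proof.
apply: contrapT => t0; pose c := t `&` con_off i.
have cp : ~ c <= con_pull (proj i) \bot.
  move/con_leP => H; apply: t0; apply: con_eq_bot => x y txy.
  apply: functional_extensionality_dep => j.
  by have [->|ji] := eqVneq j i; [exact: H | case: txy => _; exact].
have offc : con_pull (proj i) (m i) `&` con_off i <= c.
  have := Hmod VB (con_pull (proj i) \bot) (leIr (con_off i) t).
  have -> : con_pull (proj i) \bot `&` con_off i = \bot.
    apply: con_eq_bot => x y [xy oxy].
    apply: functional_extensionality_dep => j.
    by have [->|ji] := eqVneq j i; [exact: xy | exact: oxy].
  rewrite joinx0 -/c => ->; rewrite joinC.
  by apply: leI2 => //; exact: monoB.
have [a [b [[oab mab] nab]]] :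
    exists a b, nu i a b /\ ~ con_pull (coord i) \bot a b.
  apply: con_not_leP => nup; apply: (@pull_nle i).
  have /con_leP H : con_pull (coord i) (m i) <= con_pull (coord i) \bot.
    by apply: le_trans (mu_le i) _; rewrite leUx lexx.
  apply/con_leP => x y.
  have [a ax] := e_surj (x i); have [b yb] := e_surj (y i).
  by rewrite /= -ax -yb; exact: H.
have /con_leP /(_ (e a) (e b)) := offc.
case; first by split.
by move=> /t_trace ab; case: nab; rewrite ab.
Qed.

Section Socle.
Hypothesis t_soc : forall i, t <= con_pull (proj i) (m i).
Variable d : B -> B -> B -> B.
Hypothesis dP : compatible3 d.
Hypothesis dxx : forall x z, d x x z = z.
Hypothesis dt : forall x y, t x y -> d x y y = x.

Let dcon (c : Con B) x x' y y' z z' :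
  c x x' -> c y y' -> c z z' -> c (d x y z) (d x' y' z').
Proof. by move=> xx' yy' zz'; exact: (dP.1 c x x' y y' z z' z z'). Qed.

(** Because [t] permutes with the kernel of the projection, a [mu_i]-related
    pair is a [t]-related pair at coordinate [i], where [d] is Mal'cev. *)
Let d_mono i (x y : B) : ~ t <= con_pull (proj i) \bot -> m i (x i) (y i) ->
  d x y y i = x i.
Proof.
move=> tp mxy.
have : (t `|` con_pull (proj i) \bot) x y.
  by rewrite joinC; have /con_leP := monoB tp; apply.
move=> /(con_join_comp (dcon (c := t))
          (dcon (c := con_pull (proj i) \bot)) dxx).
case=> [u v tuv|z [txz pzy]]; first by rewrite dt //; exact: con_refl.
have := @dcon (con_pull (proj i) \bot) x x y z y z (con_refl (_ : Con B) x)
  (con_sym pzy) (con_sym pzy).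
by rewrite (dt txz).
Qed.

(** Surjectivity gives some element of [A] with [i]-th coordinate [u]; it is
    related to [a] by the join of the coordinate kernel and [nu i], and these
    permute thanks to [d], so [a] can be moved by [nu i] alone. *)
Let replace_coord i a (u : C i) : ~ t <= con_pull (proj i) \bot ->
  m i (e a i) u -> exists b, e b i = u /\ con_off i (e a) (e b).
Proof.
move=> tp mau; have [c cu] := e_surj u.
(* The image of [A] is a subuniverse, so [d] restricts to [A]. *)
have ran x y z : exists w, e w = d (e x) (e y) (e z).
  apply: (dP.2 (fun b => exists w, e w = b) _ _ _ _ (e x)); try by eexists.
  move=> f v vP; have [w wv] := choice vP.
  by exists (op A f w); rewrite hom_op; congr (op _ f); apply/funext.
pose dA x y z := sval (cid (ran x y z)).
have dAE x y z : e (dA x y z) = d (e x) (e y) (e z) := svalP (cid (ran x y z)).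
have : (nu i `|` con_pull (coord i) \bot) a c.
  by rewrite joinC; have /con_leP := mu_le i; apply; rewrite /= cu.
move=> /(@con_join_comp _ _ _ _ dA); case.
- move=> x x' y y' z z' [ox mx] [oy my] [oz mz].
  split; rewrite /= !dAE; first exact: (dcon (c := con_off i)).
  exact: (dcon (c := con_pull (proj i) (m i))).
- move=> x x' y y' z z' xx' yy' zz'; rewrite /= !dAE.
  exact: (dcon (c := con_pull (proj i) \bot)).
- by move=> x z; apply: e_inj; rewrite dAE dxx.
- by move=> x y [_ mxy]; rewrite /= dAE; exact: d_mono.
- by move=> b [[oab _] bc]; exists b; split=> //; rewrite -cu.
Qed.

Let saturated a (x : B) : t (e a) x -> exists b, e b = x.
Proof.
move=> tax.
suff step j : (j <= n)%N -> exists b, forall i : 'I_n,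
    e b i = if (i < j)%N then x i else e a i.
  have [b bx] := step n (leqnn n); exists b.
  by apply: functional_extensionality_dep => i; rewrite bx ltn_ord.
elim: j => [|j IH] jn; first by exists a.
have [b bx] := IH (ltnW jn); pose i := Ordinal jn.
have [b' [b'i b'o]] : exists b', e b' i = x i /\ con_off i (e b) (e b').
  have bi : e b i = e a i by rewrite bx ltnn.
  have [ax|ax] := pselect (e a i = x i).
    by exists b; split; [rewrite bi | exact: con_refl].
  apply: replace_coord; first by move/con_leP => H; apply: ax; exact: H.
  by rewrite bi; have /con_leP := t_soc i; apply.
exists b' => k; have [->|ki] := eqVneq k i; first by rewrite b'i /= ltnSn.
rewrite -b'o // bx ltnS [(k <= j)%N]leq_eqVlt.
by case: eqP => // kj; case/eqP: ki; exact: val_inj.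
Qed.

(** Every element [t]-related to [a] in [A] lies in [A], hence equals [a]. In
    particular [d x y a = a = d y y a], and centrality replaces [a] by [y]. *)
Lemma trace_socle_bot : t = \bot.
Proof.
apply: con_eq_bot => x y txy.
case: (algebra_nonempty A) => a.
have taw : t (e a) (d x y (e a)).
  rewrite -{1}(dxx y (e a)); apply: dcon; [exact: con_sym | |]; exact: con_refl.
have [b bw] := saturated taw.
have ab : a = b by apply: t_trace; rewrite bw.
have E : d x y (e a) = d y y (e a) by rewrite dxx -bw ab.
have := @meet_off_central t trace_off_bot _ dP x y y y y y (e a) y txy
  (con_refl _ y) (con_refl _ y) E.
by rewrite dt // dxx.
Qed.

End Socle.
End Trace.

(** An irredundant subdirect embedding into a finite product of subdirectly
    irreducible algebras is essential. *)
Lemma irredundant_essential (t : Con B) :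
  (forall a b, t (e a) (e b) -> a = b) -> t = \bot.
Proof.
move=> te; apply: contrapT => /below_socle[s [/con_leP st s0 sm]].
have se a b : s (e a) (e b) -> a = b by move=> /st; exact: te.
apply: s0.
have [d [dP dxx dc]] := difference_operation HV Hmod VB.
apply: (trace_socle_bot se sm dP dxx) => x y; apply: dc => //.
apply: meet_off_central => i; exact: trace_off_bot.
Qed.

End Essential.

(** * Decomposition of the zero congruence *)

Section FiniteHeight.
Context d (L : porderType d) (Lfin : finite_height L).

Lemma finite_height_max (P : L -> Prop) x0 : P x0 ->
  exists2 x, P x & forall y, x < y -> ~ P y.
Proof.
move=> Px0; apply: contrapT => N; have [n nP] := Lfin.
have up x : P x -> exists y, P y /\ x < y.
  move=> Px; apply: contrapT => Nx; apply: N; exists x => // y xy Py.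
  by apply: Nx; exists y.
suff chain k : exists x s, [/\ P x, path >%O x s & size s = k].
  have [x [s [_ xs sn]]] := chain n.
  have := nP (rev (x :: s)); rewrite size_rev /= sn ltnn.
  by rewrite rev_sorted /= => /(_ xs).
elim: k => [|k [x [s [Px xs sk]]]]; first by exists x0, [::].
have [y [Py xy]] := up x Px.
by exists y, (x :: s); rewrite /= xy xs sk.
Qed.

Lemma finite_height_min (P : L -> Prop) x0 : P x0 ->
  exists2 x, P x & forall y, y < x -> ~ P y.
Proof.
move=> Px0; apply: contrapT => N; have [n nP] := Lfin.
have dn x : P x -> exists y, P y /\ y < x.
  move=> Px; apply: contrapT => Nx; apply: N; exists x => // y xy Py.
  by apply: Nx; exists y.
suff chain k : exists x s, [/\ P x, path <%O x s & size s = k].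
  have [x [s [_ xs sn]]] := chain n.
  by have := nP (x :: s) xs; rewrite /= sn ltnn.
elim: k => [|k [x [s [Px xs sk]]]]; first by exists x0, [::].
have [y [Py xy]] := dn x Px.
by exists y, (x :: s); rewrite /= xy xs sk.
Qed.

End FiniteHeight.

Section Decomposition.
Context (S : signature) (A : algebra S).

(** Stated by an upper cover [k] that lies below everything above [m]. *)
Definition completely_meet_irreducible (m : Con A) :=
  exists2 k : Con A, m < k & forall c, m < c -> k <= c.

Hypothesis Afin : finite_height (Con A).

(** A congruence maximal among those separating [a] and [b] is completely meet
    irreducible: its upper cover is obtained by adding the pair [(a, b)]. *)
Lemma separating_irreducible (a b : A) : a <> b ->
  exists2 m : Con A, completely_meet_irreducible m & ~ m a b.
Proof.
move=> ab.
have [m mab mmax] := finite_height_max Afin (P := fun c : Con A => ~ c a b)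
  (x0 := \bot) ab.
exists m => //.
exists (con_gen (fun u v => m u v \/ (u = a /\ v = b))).
  rewrite lt_neqAle; apply/andP; split; last first.
    by apply/con_leP => x y mxy c; apply; left.
  by apply/eqP => mE; apply: mab; rewrite mE => c; apply; right.
move=> c mc; apply/con_leP => x y; apply=> u v [muv|[-> ->]].
  by move/ltW/con_leP: mc; apply.
by apply: contrapT; exact: mmax.
Qed.

Definition irreducible_decomposition n :=
  exists m : 'I_n -> Con A, (forall i, completely_meet_irreducible (m i)) /\
    forall x y, (forall i, m i x y) -> x = y.

(** Take a minimal congruence among those that contain a finite meet of
    irreducibles; were it nonzero, meeting it with an irreducible that separates
    one of its pairs would make it smaller. *)
Lemma irreducible_decomposition_exists : exists n, irreducible_decomposition n.
Proof.
pose P (c : Con A) := exists s : seq (Con A),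
  (forall m, m \in s -> completely_meet_irreducible m) /\
  forall x y, (forall m, m \in s -> m x y) -> c x y.
have [c [s [sirr sc]] cmin] : exists2 c, P c & forall c', c' < c -> ~ P c'.
  apply: (finite_height_min Afin (x0 := \top)).
  by exists [::]; split.
have c0 : c = \bot.
  apply: contrapT => /con_neq_botP[a [b [cab ab]]].
  have [m mirr mab] := separating_irreducible ab.
  apply: (cmin (c `&` m)).
    rewrite lt_neqAle leIl andbT; apply/eqP => cm.
    by move: cab; rewrite -cm => -[].
  exists (m :: s); split=> [k|x y H].
    by rewrite in_cons => /orP[/eqP->|/sirr].
  split; last by apply: H; rewrite mem_head.
  by apply: sc => k ks; apply: H; rewrite in_cons ks orbT.
exists (size s), (tnth (in_tuple s)); split=> [i|x y H].
  by apply: sirr; exact: mem_tnth.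
suff : c x y by rewrite c0.
by apply: sc => k /(tnthP (in_tuple s))[i ->].
Qed.

(** A decomposition with the fewest members is irredundant. *)
Lemma irredundant_decomposition :
  exists n (m : 'I_n -> Con A),
  [/\ forall i, completely_meet_irreducible (m i),
      forall x y, (forall i, m i x y) -> x = y &
      forall i, exists a b, a <> b /\ forall j, j != i -> m j a b].
Proof.
have ex : exists n, `[< irreducible_decomposition n >].
  by have [n nP] := irreducible_decomposition_exists; exists n; apply/asboolP.
case: (ex_minnP ex) => n /asboolP[m [mirr m0]] nmin.
exists n, m; split=> //.
case: n m mirr m0 nmin => [|n] m mirr m0 nmin i; first by case: i.
apply: contrapT => N.
suff /asboolP/nmin : irreducible_decomposition n by rewrite ltnn.
exists (fun k => m (lift i k)); split=> // x y H.
apply: contrapT => xy; apply: N; exists x, y; split=> // j.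
by rewrite eq_sym => /unlift_some[k -> _].
Qed.

End Decomposition.

Section Quotient.
Context (S : signature) (A : algebra S) (m : Con A).

(** A chosen element of the class of [x]. As the choice depends on the class
    alone, the fixed points of [repr] represent the quotient. *)
Definition repr (x : A) : A := sval (cid (ex_intro (m x) x (con_refl m x))).

Lemma reprP x : m x (repr x).
Proof. exact: svalP (cid _). Qed.

Lemma repr_eq x y : m x y -> repr x = repr y.
Proof.
move=> mxy; have E : con_rel m x = con_rel m y.
  apply/funext => z; apply/propext; split=> h; last exact: con_trans mxy h.
  exact: con_trans (con_sym mxy) h.
suff cidE (P Q : A -> Prop) p q :
    P = Q -> sval (@cid A P p) = sval (@cid A Q q).
  exact: cidE.
move=> PQ; case: _ / PQ in q *; congr (sval (cid _)).
exact: Prop_irrelevance.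
Qed.

Lemma repr_idem x : repr (repr x) = repr x.
Proof. by apply: repr_eq; apply: con_sym; exact: reprP. Qed.

Definition class (x : A) : {x : A | repr x = x} := exist _ _ (repr_idem x).

Lemma quot_nonempty : inhabited {x : A | repr x = x}.
Proof. by case: (algebra_nonempty A) => x; exists; exact: class x. Qed.

Definition quot : algebra S :=
  @Algebra S {x : A | repr x = x}
    (fun f x => class (op A f (fun k => sval (x k)))) quot_nonempty.

Lemma class_eq x y : class x = class y <-> m x y.
Proof.
split=> [[xy]|/repr_eq xy]; last exact: eq_exist.
by apply: con_trans (reprP x) _; rewrite xy; apply: con_sym; exact: reprP.
Qed.

Lemma class_op f (x : 'I_(arity f) -> A) :
  (class (op A f x) : quot) = op quot f (fun k => class (x k)).
Proof. by apply/class_eq; apply: con_op => k; exact: reprP. Qed.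

Definition quot_hom : hom A quot := @Hom S A quot class class_op.

Lemma quot_surj : surjective quot_hom.
Proof. by case=> x xx; exists x; apply: eq_exist. Qed.

Lemma quot_subdirectly_irreducible :
  completely_meet_irreducible m -> subdirectly_irreducible quot.
Proof.
move=> [k mk kmin].
have ker : con_pull quot_hom \bot = m.
  by apply: con_eq => x y; exact: class_eq.
have kk : con_pull quot_hom \bot <= k by rewrite ker; exact: ltW.
exists (con_push quot_surj kk); split.
  move=> k0; move: mk; rewrite lt_neqAle => /andP[/eqP mk /con_leP mlek].
  apply: mk; apply: con_eq => x y; split; first exact: mlek.
  move=> kxy; apply/class_eq.
  suff : con_push quot_surj kk (class x) (class y) by rewrite k0.
  move=> x' y' /class_eq/mlek xx' /class_eq/mlek yy'.
  exact: con_trans xx' (con_trans kxy (con_sym yy')).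
move=> c c0; apply/con_leP => u v.
have [x <-] := quot_surj u; have [y <-] := quot_surj v.
move=> /(_ x y erefl erefl).
suff /kmin/con_leP : m < con_pull quot_hom c by apply.
rewrite lt_neqAle; apply/andP; split; last first.
  by apply/con_leP => a b /class_eq /= ->; exact: con_refl.
apply/eqP => mc; apply: c0; apply: con_eq_bot => a b.
have [a' <-] := quot_surj a; have [b' <-] := quot_surj b => cab.
by apply/class_eq; rewrite mc.
Qed.

End Quotient.

Theorem theorem4p2 (S : signature) (V : algebra S -> Prop)
    (HV : variety V) (Hmod : congruence_modular V)
    (A : algebra S) (HA : absolute_retract V A)
    (Hfin : finite_height (Con A)) :
  exists (n : nat) (B : 'I_n -> algebra S),
    (forall i : 'I_n, subdirectly_irreducible (B i)) /\
    isomorphic A (prod_alg B).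
Proof.
have [VA retr] := HA.
have [n [m [mirr m0 mirrd]]] := irredundant_decomposition Hfin.
have si i := quot_subdirectly_irreducible (mirr i).
exists n, (fun i => quot (m i)); split=> //.
have VB : V (prod_alg (fun i => quot (m i))).
  by apply: varietyP => // i; apply: varietyH (quot_surj (m := m i)) VA.
pose e := @Hom S A (prod_alg (fun i => quot (m i))) (fun x i => class (m i) x)
  (fun f x => functional_extensionality_dep (fun i => class_op (m i) x)).
have e_inj : injective e.
  move=> x y exy; apply: m0 => i; apply/class_eq.
  exact: (congr1 (fun z => z i) exy).
have [p [_ pe]] := retr _ e VB e_inj.
pose mu i := sval (cid (si i)).
have muP i : mu i <> \bot /\ forall c, c <> \bot -> mu i <= c :=
  svalP (cid (si i)).
exists e; exists p => // z.
suff k0 : con_pull p \bot = \bot.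
  suff : (con_pull p \bot) (e (p z)) z by rewrite k0.
  exact: pe.
apply: (@irredundant_essential S n _ V HV Hmod A e VA VB mu) => //.
- by move=> i; case: (muP i).
- by move=> i; case: (muP i).
- by move=> i u; have [a au] := quot_surj u; exists a.
- move=> i; have [a [b [ab abj]]] := mirrd i; exists a, b; split=> // j ji.
  by apply/class_eq; exact: abj.
- by move=> a b; rewrite /= !pe.
Qed.
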